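(* Let $U,V,W\subset\mathbb{C}$ be nonempty compact sets such that $(U,V,W)$ is compatible and $\kappa:=\kappa(U,V,W)\in\{-1,1\}$, and let $p\in[1,\infty]$. Let $S$ denote the forward shift on $\ell^p(\mathbb{Z})$, $(Sx)(j+1)=x(j)$ for all $j\in\mathbb{Z}$. Then for every $A\in M(U,V,W)$ the full finite section method, and hence the finite section method with arbitrary monotonic cut-off sequences $l_n\to-\infty$, $r_n\to+\infty$, applies to $S^{\kappa}A$ as an operator on $\ell^p(\mathbb{Z})$. Moreover, every finite principal submatrix of $S^\kappa A$ is invertible, so that the truncated systems are uniquely solvable for all $n$.
   Context: $\mathbb{N}=\{1,2,\dots\}$. $M(U,V,W)$ is the set of bi-infinite tridiagonal matrices $A=(a_{ij})_{i,j\in\mathbb{Z}}$ with $a_{i,i-1}\in U$, $a_{i,i}\in V$, $a_{i,i+1}\in W$ for all $i$, all other entries zero. $M_+(U,V,W)$ is the set of semi-infinite tridiagonal matrices $(a_{ij})_{i,j\in\mathbb{N}}$ with subdiagonal entries in $U$, diagonal entries in $V$, superdiagonal entries in $W$, all other entries zero. They act as bounded operators on $\ell^p(\mathbb{Z})$, $\ell^p(\mathbb{N})$; invertibility, Fredholmness and Fredholm index do not depend on $p$. The index of a Fredholm operator is the dimension of its null space minus the codimension of its image. $(U,V,W)$ is compatible if all operators in $M(U,V,W)$ are invertible (equivalently, all operators in $M_+(U,V,W)$ are Fredholm). If $(U,V,W)$ is compatible, all $B_+\in M_+(U,V,W)$ are Fredholm with one and the same index, denoted $\kappa(U,V,W)\in\{-1,0,1\}$.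 Finite section method (FSM): for a bi-infinite band matrix $A=(a_{ij})_{i,j\in\mathbb Z}$ and integer cut-off sequences $l_n\to-\infty$, $r_n\to+\infty$, the equation $Ax=b$ is replaced by $\sum_{l_n\le j\le r_n}a_{ij}x_n(j)=b(i)$, $l_n\le i\le r_n$. The FSM applies to $A$ if $A$ is invertible, the truncated systems are uniquely solvable for all sufficiently large $n$ and every $b$, and, for every $b$, the solutions $x_n$ (extended by zero) approximate the solution $x$ of $Ax=b$: $\|x_n-x\|\to0$ if $p<\infty$; $\|x_n\|=O(1)$ and $x_n(j)\to x(j)$ for every $j$ if $p=\infty$. Equivalently, $A$ is invertible and $A_n=(a_{ij})_{i,j=l_n}^{r_n}$ are invertible for all large $n$ with $\limsup_n\|A_n^{-1}\|<\infty$. The full FSM is the choice $l_n=-n$, $r_n=n$. *)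

(* Defs.v *)
From HB Require Import structures.
From mathcomp Require Import all_boot all_order all_algebra.
From mathcomp Require Import all_classical all_reals all_analysis.
From mathcomp Require Import complex.

Set Implicit Arguments.
Unset Strict Implicit.
Unset Printing Implicit Defensive.

Import Order.TTheory GRing.Theory Num.Theory.
Import numFieldNormedType.Exports.

Local Open Scope classical_set_scope.
Local Open Scope ring_scope.

(* The discrete sigma-algebra on the integers, so that l^p(Z), like l^p(nat),
   is L^p of the counting measure. *)
HB.instance Definition _ := isPointed.Build int 0.
HB.instance Definition _ := @isMeasurable.Build default_measure_display
  int discrete_measurable discrete_measurable0
  discrete_measurableC discrete_measurableU.

(* Vectors are functions x : I -> R[i], with I = int or I = nat; index 0 of
   nat stands for the index 1 of {1, 2, ...}. *)

Definition lpnorm (R : realType) d (I : measurableType d) (p : \bar R)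
    (x : I -> R[i]) : \bar R :=
  Lnorm counting p (fun i => (ComplexField.Normc.normc (x i))%:E).

Definition lp (R : realType) d (I : measurableType d) (p : \bar R)
    : set (I -> R[i]) :=
  [set x | (lpnorm p x < +oo)%E].

(* Operators on l^p are total maps T on I -> R[i], of which only the values on
   [lp p] matter. *)
Definition bounded_operator (R : realType) d (I : measurableType d)
    (p : \bar R) (T : (I -> R[i]) -> I -> R[i]) : Prop :=
  [/\ forall x, lp p x -> lp p (T x),
      forall (c : R[i]) x y, lp p x -> lp p y ->
        T (fun i => c * x i + y i) = (fun i => c * T x i + T y i)
    & exists M : R, forall x, lp p x -> (lpnorm p (T x) <= M%:E * lpnorm p x)%E].

Definition invertible (R : realType) d (I : measurableType d)
    (p : \bar R) (T : (I -> R[i]) -> I -> R[i]) : Prop :=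
  bounded_operator p T /\
  exists B, bounded_operator p B /\
    forall x, lp p x -> B (T x) = x /\ T (B x) = x.

(* [quotient_dim V W n]: the quotient of V by its subspace W has dimension n,
   i.e. there are n vectors of V whose classes modulo W form a basis. *)
Definition quotient_dim (R : realType) (I : Type) (V W : set (I -> R[i]))
    (n : nat) : Prop :=
  exists v : 'I_n -> I -> R[i], (forall k, V (v k)) /\
    forall y, V y ->
      exists! c : 'rV[R[i]]_n, W (fun i => y i - \sum_(k < n) c 0 k * v k i).

(* T is Fredholm on l^p with index k; finite codimension of the image already
   forces the image to be closed. *)
Definition fredholm_index (R : realType) d (I : measurableType d)
    (p : \bar R) (T : (I -> R[i]) -> I -> R[i]) (k : int) : Prop :=
  bounded_operator p T /\
  exists n m : nat,
    [/\ quotient_dim [set x | lp p x /\ T x = cst 0] [set cst 0] n,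
        quotient_dim (lp p) [set T x | x in lp p] m
      & k = n%:Z - m%:Z].

(* The sums over j below are finitely supported sums: they are the usual ones
   for matrices with finitely many nonzero entries in each row, in particular
   for band matrices. *)
Definition infmx_act (R : realType) (I : choiceType) (a : I -> I -> R[i])
    (x : I -> R[i]) : I -> R[i] :=
  fun i => \sum_(j \in [set: I]) a i j * x j.

Definition infmx_mul (R : realType) (I : choiceType) (a b : I -> I -> R[i])
    : I -> I -> R[i] :=
  fun i j => \sum_(k \in [set: I]) a i k * b k j.

(* Matrix of the k-th power S^k of the forward shift (S x)(j + 1) = x j; see
   [shiftmxE]. *)
Definition shiftmx (R : realType) (k : int) : int -> int -> R[i] :=
  fun i j => (i == j + k)%:R.

Lemma fsbig_shift (R : realType) (k i : int) (f : int -> R[i]) :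
  \sum_(j \in [set: int]) shiftmx R k i j * f j = f (i - k).
Proof.
rewrite -(fsbig_widen [set i - k] setT) ?fsbig_set1//.
  by rewrite /shiftmx subrK eqxx mul1r.
move=> j [_ /= ji]; rewrite /shiftmx; case: eqP => [ijk|_]; last by rewrite mul0r.
by case: ji; rewrite ijk addrK.
Qed.

Lemma shiftmxE (R : realType) (k : int) (x : int -> R[i]) (j : int) :
  infmx_act (shiftmx R k) x (j + k) = x j.
Proof. by rewrite /infmx_act fsbig_shift addrK. Qed.

Lemma shiftmx_mulE (R : realType) (k : int) (a : int -> int -> R[i]) i j :
  infmx_mul (shiftmx R k) a i j = a (i - k) j.
Proof. exact: (fsbig_shift k i (a^~ j)). Qed.

Definition tridiagZ (R : realType) (U V W : set R[i])
    : set (int -> int -> R[i]) :=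
  [set a | [/\ forall i, U (a i (i - 1)), forall i, V (a i i),
               forall i, W (a i (i + 1))
             & forall i j, 1 < `|i - j| -> a i j = 0]].

Definition tridiagN (R : realType) (U V W : set R[i])
    : set (nat -> nat -> R[i]) :=
  [set a | [/\ forall i, U (a i.+1 i), forall i, V (a i i),
               forall i, W (a i i.+1)
             & forall i j, (i.+1 < j)%N \/ (j.+1 < i)%N -> a i j = 0]].

Definition compatible (R : realType) (p : \bar R) (U V W : set R[i]) : Prop :=
  forall a, tridiagZ U V W a -> invertible p (infmx_act a).

(* k is the common Fredholm index of all operators in M_+(U, V, W); it is
   unique as soon as U, V, W are nonempty. *)
Definition common_index (R : realType) (p : \bar R) (U V W : set R[i])
    (k : int) : Prop :=
  forall b, tridiagN U V W b -> fredholm_index p (infmx_act b) k.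

(* x, extended by zero outside {l, ..., r}, solves the truncated system. *)
Definition truncated_solution (R : realType) (a : int -> int -> R[i])
    (l r : int) (b x : int -> R[i]) : Prop :=
  (forall j, ~ (l <= j <= r) -> x j = 0) /\
  (forall i, l <= i <= r ->
    \sum_(j \in [set j : int | l <= j <= r]) a i j * x j = b i).

Definition approximates (R : realType) (p : \bar R)
    (xs : nat -> int -> R[i]) (x : int -> R[i]) : Prop :=
  if (p < +oo)%E then
    lpnorm p (fun j => xs n j - x j) @[n --> \oo] --> 0%E
  else
    (exists M : R, \forall n \near \oo, (lpnorm p (xs n) <= M%:E)%E) /\
    (forall j, (xs n j : R[i]^o) @[n --> \oo] --> (x j : R[i]^o)).

Definition cutoffs (l r : nat -> int) : Prop :=
  (forall k : int, \forall n \near \oo, l n <= k) /\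
  (forall k : int, \forall n \near \oo, k <= r n).

Definition monotonic_cutoffs (l r : nat -> int) : Prop :=
  [/\ cutoffs l r,
      {homo l : m n / (m <= n)%N >-> n <= m}
    & {homo r : m n / (m <= n)%N >-> m <= n}].

Definition fsm_applies (R : realType) (p : \bar R) (a : int -> int -> R[i])
    (l r : nat -> int) : Prop :=
  [/\ invertible p (infmx_act a),
      \forall n \near \oo, forall b, lp p b ->
        exists! x, truncated_solution a (l n) (r n) b x
    & forall b x, lp p b -> lp p x -> infmx_act a x = b ->
      forall xs : nat -> int -> R[i],
        (\forall n \near \oo, truncated_solution a (l n) (r n) b (xs n)) ->
        approximates p xs x].

Definition principal_submx (R : realType) (a : int -> int -> R[i]) (m : nat)
    (f : 'I_m -> int) : 'M[R[i]]_m :=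
  \matrix_(i < m, j < m) a (f i) (f j).

(* Main.v *)
(** The row shift turns the tridiagonal [A] into a triangular band matrix
    [SA = S^kappa A]: lower triangular with the superdiagonal of [A] on its
    diagonal for kappa = 1, upper triangular with the subdiagonal of [A] on its
    diagonal for kappa = -1.  The index of the compressions [A_+] of [A] to the
    half-lines [[k, +oo)] forces the inverse of [SA] to be triangular as well.
    For kappa = 1, [A_+] is onto with a kernel spanned by one vector [v], and
    [A (k - 1) k * v 0 <> 0] since otherwise [v], extended by zero, would be
    killed by [A]; correcting by a multiple of [v] solves [SA x = y] inside
    [[k, +oo)].  For kappa = -1, [A] is onto, so the image of [A_+] together
    with [e_0] is everything; hence [A_+] is injective and [e_0] is not in its
    image, so that [SA x = 0] on [[k, +oo)] implies [x = 0] there.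

    Consequently the truncated inverse is [P SA^-1 P], with norm at most that of
    [SA^-1]; this gives stability, and convergence when p < oo.  For p = oo the
    entrywise convergence is local: a bounded [w] with [SA w = 0] on
    [[j - N, j + N]] satisfies [w j = O(1 / N)], by applying the lower bound of
    [SA] to [w] times a tent function. *)
Require Import Defs.
From mathcomp Require Import all_boot all_order all_algebra.
From mathcomp Require Import finmap.
From mathcomp Require Import all_classical all_reals all_analysis.
From mathcomp Require Import complex ess_sup_inf.
From mathcomp Require Import zify ring.

Set Implicit Arguments.
Unset Strict Implicit.
Unset Printing Implicit Defensive.

Import Order.TTheory GRing.Theory Num.Theory.
Import numFieldNormedType.Exports.
Local Open Scope classical_set_scope.
Local Open Scope ring_scope.

Local Notation normc := ComplexField.Normc.normc.

(** * Norms on l^p of a discrete space *)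

Section LpNorm.
Context {R : realType} d {I : measurableType d}.
Hypothesis mI : forall A : set I, measurable A.
Implicit Types (x y : I -> R[i]) (p : \bar R).

Lemma measurable_discrete d' {T : sigmaRingType d'} D (f : I -> T) :
  measurable_fun D f.
Proof. by move=> _ Y _; exact: mI. Qed.

Lemma lpnorm_ge0 p x : (0 <= lpnorm p x)%E.
Proof. exact: Lnorm_ge0. Qed.

Lemma counting_eq0 (A : set I) : counting A = 0%E :> \bar R -> A = set0.
Proof.
rewrite /counting; case: ifPn => // /asboolP finA [] /eqP.
by rewrite pnatr_eq0 cardfs_eq0 => /eqP /(fset_set_set0 finA).
Qed.

(** Only the empty set is null for the counting measure. *)
Lemma ae_counting (P : I -> Prop) :
  {ae (@counting I R), forall i, P i} -> forall i, P i.
Proof.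
move=> [N [_ /counting_eq0 -> sPN]] i.
by apply: contrapT => nPi; exact: (sPN _ nPi).
Qed.

Lemma normc_ge0 (z : R[i]) : 0 <= normc z.
Proof. by case: z => a b; exact: sqrtr_ge0. Qed.

Lemma lpnormE (r : R) x : lpnorm r%:E x =
  ((\int[counting]_i (normc (x i) `^ r)%:E) `^ r^-1)%E.
Proof.
rewrite /lpnorm unlock; congr (_ `^ _)%E; apply: eq_integral => i _.
by rewrite abse_EFin poweR_EFin ger0_norm ?normc_ge0.
Qed.

Lemma lpnorm_infty_le x (M : \bar R) :
  (lpnorm +oo x <= M)%E <-> forall i, ((normc (x i))%:E <= M)%E.
Proof.
have -> : lpnorm +oo x = ess_sup counting (fun i => (normc (x i))%:E).
  (* For exponent [+oo], [Lnorm] is the essential supremum only if the whole space has positive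
     measure; [point] witnesses that [I] is nonempty. *)
  rewrite /lpnorm unlock ifT; last first.
    rewrite lt0e measure_ge0 andbT; apply/eqP => /counting_eq0 I0.
    by have : [set: I] point by []; rewrite I0.
  congr ess_sup; apply/funext => i /=.
  by rewrite ger0_norm ?normc_ge0.
split=> [/ess_supP /ae_counting//|xM].
by apply/ess_supP; apply/nearW.
Qed.

Lemma le_lpnorm p x y : (0 < p)%E -> (forall i, normc (x i) <= normc (y i)) ->
  (lpnorm p x <= lpnorm p y)%E.
Proof.
case: p => [r|_ xy|//]; last first.
  apply/lpnorm_infty_le => i; apply: (@le_trans _ _ (normc (y i))%:E).
    by rewrite lee_fin.
  by move: i; apply/lpnorm_infty_le.
rewrite lte_fin => r0 xy; rewrite !lpnormE.
apply: gt0_ler_poweR.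
- by rewrite invr_ge0 ltW.
- by rewrite in_itv/= leey andbT integral_ge0// => i _; rewrite lee_fin powR_ge0.
- by rewrite in_itv/= leey andbT integral_ge0// => i _; rewrite lee_fin powR_ge0.
apply: ge0_le_integral => // i _; rewrite lee_fin ?powR_ge0//.
by apply: ge0_ler_powR; rewrite ?nnegrE ?normc_ge0// ltW.
Qed.

Lemma lpnormD p x y : (1 <= p)%E ->
  (lpnorm p (fun i => x i + y i)%R <= lpnorm p x + lpnorm p y)%E.
Proof.
move=> p1; pose nx i := normc (x i); pose ny i := normc (y i).
have := @eminkowski _ _ _ (@counting I R) nx ny p
  (@measurable_discrete _ _ _ _) (@measurable_discrete _ _ _ _) p1.
apply: le_trans.
have -> : ('N[(@counting I R)]_p[EFin \o (nx \+ ny)%R])%E =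
   lpnorm p (fun i => (nx i + ny i)%:C%C).
  apply: eq_Lnorm => i /=.
  by rewrite expr0n addr0 sqrtr_sqr ger0_norm// addr_ge0 ?normc_ge0.
apply: le_lpnorm => [|i]; first exact: lt_le_trans p1.
rewrite [X in _ <= X]/= expr0n addr0 sqrtr_sqr ger0_norm ?addr_ge0 ?normc_ge0//.
exact: le_normcD.
Qed.

Lemma lpnormZ p (c : R[i]) x : (0 < p)%E ->
  (lpnorm p (fun i => c * x i)%R <= (normc c)%:E * lpnorm p x)%E.
Proof.
case: p => [r|_|//]; last first.
  apply/lpnorm_infty_le => i; rewrite ComplexField.Normc.normcM EFinM.
  apply: lee_wpmul2l; first by rewrite lee_fin normc_ge0.
  by move: i; apply/lpnorm_infty_le.
rewrite lte_fin => r0; rewrite !lpnormE.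
under eq_integral do
  rewrite ComplexField.Normc.normcM powRM ?normc_ge0// EFinM.
rewrite ge0_integralZl//; last 2 first.
- by move=> i _; rewrite lee_fin powR_ge0.
- by rewrite lee_fin powR_ge0.
rewrite poweRM ?lee_fin ?powR_ge0//; last first.
  by apply: integral_ge0 => i _; rewrite lee_fin powR_ge0.
by rewrite poweR_EFin -powRrM divff ?gt_eqF// powRr1 ?normc_ge0.
Qed.

Lemma lp_linear p (c : R[i]) x y : (1 <= p)%E -> lp p x -> lp p y ->
  lp p (fun i => c * x i + y i).
Proof.
move=> p1 xp yp; rewrite /lp/=.
apply: le_lt_trans (lpnormD (fun i => c * x i) y p1) _.
apply: lte_add_pinfty => //.
have p0 : (0 < p)%E by exact: lt_le_trans p1.
apply: le_lt_trans (lpnormZ c x p0) _.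
by apply: lte_mul_pinfty => //; rewrite lee_fin normc_ge0.
Qed.

Lemma lp0 p : (1 <= p)%E -> lp p (cst 0 : I -> R[i]).
Proof.
move=> p1; rewrite /lp/= (_ : lpnorm _ _ = 0%E)//.
rewrite -(@Lnorm0 _ _ _ (@counting I R) p); last by rewrite gt_eqF// (lt_le_trans _ p1).
by apply: eq_Lnorm => i/=; rewrite expr0n addr0 sqrtr0.
Qed.

Lemma lp_finP (r : R) x : 0 < r -> lp r%:E x <->
  (\int[counting]_i (normc (x i) `^ r)%:E < +oo)%E.
Proof.
move=> r0; rewrite /lp /= lpnormE; split; last exact: poweR_lty.
by apply: lty_poweRy; rewrite invr_eq0 gt_eqF.
Qed.

Lemma lp_inftyP x : lp +oo x <-> exists M : R, forall i, normc (x i) <= M.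
Proof.
split=> [xoo|[M xM]].
  exists (fine (lpnorm +oo x)) => i.
  rewrite -lee_fin fineK; last by rewrite ge0_fin_numE ?lpnorm_ge0.
  by move: i; apply/lpnorm_infty_le.
rewrite /lp/=; apply: (@le_lt_trans _ _ M%:E); last exact: ltry.
by apply/lpnorm_infty_le => i; rewrite lee_fin.
Qed.

Lemma lp_finite_support p x (A : set I) : (1 <= p)%E -> finite_set A ->
  (forall i, ~ A i -> x i = 0) -> lp p x.
Proof.
move=> p1 finA xA.
have [M0 [Mge0 xM]] : exists M : R, 0 <= M /\ forall i, normc (x i) <= M.
  exists (\sum_(i <- fset_set A) normc (x i)).
  split=> [|i]; first by apply: sumr_ge0 => i _; exact: normc_ge0.
  have [Ai|/xA->] := pselect (A i); last first.
    by rewrite /= expr0n addr0 sqrtr0 sumr_ge0// => j _; exact: normc_ge0.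
  have iA : i \in fset_set A by rewrite in_fset_set ?mem_set.
  rewrite (big_fsetD1 i iA) lerDl.
  by apply: sumr_ge0 => j _; exact: normc_ge0.
case: p p1 => [r|_|//]; last by apply/lp_inftyP; exists M0.
rewrite lee_fin => r1; have r0 : 0 < r by exact: lt_le_trans r1.
apply/lp_finP => //.
rewrite (_ : integral _ _ _ =
  (\int[counting]_(i in A) (normc (x i) `^ r)%:E)%E); last first.
  rewrite [RHS]integral_mkcond; apply: eq_integral => i _.
  rewrite patchE; case: ifPn => // /negP; rewrite inE => /xA ->.
  by rewrite /= expr0n addr0 sqrtr0 powR0 ?gt_eqF.
apply: (@le_lt_trans _ _ (\int[counting]_(i in A) (M0 `^ r)%:E)%E).
  apply: ge0_le_integral => // i _; rewrite ?lee_fin ?powR_ge0//.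
  by apply: ge0_ler_powR; rewrite ?nnegrE ?normc_ge0// ltW.
rewrite integral_cst// lte_mul_pinfty ?lee_fin ?powR_ge0//.
by rewrite /= /counting; case: ifPn => [_|/asboolP//]; rewrite ltry.
Qed.

End LpNorm.

(** * Change of index set along an injection *)

Section Reindex.
Context {R : realType} {d d' : measure_display}.
Context {I : measurableType d} {J : measurableType d'}.
Hypothesis mI : forall A : set I, measurable A.
Hypothesis mJ : forall A : set J, measurable A.
Context (e : I -> J) (e_inj : injective e).
Implicit Types (y : J -> R[i]) (p : \bar R).

Lemma counting_preimage (D : set J) : D `<=` range e ->
  counting (e @^-1` D) = counting D :> \bar R.
Proof.
move=> De; have eK : e @` (e @^-1` D) = D.
  apply/seteqP; split=> [_ [i Di <-]//|j Dj].
  by have [i _ eij] := De _ Dj; exists i => //=; rewrite eij.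
rewrite -[in RHS]eK /counting; case: (pselect (finite_set (e @^-1` D))) => fin.
  rewrite !asboolT//; last exact: finite_image.
  by rewrite fset_set_image// card_imfset.
rewrite !asboolF//; apply: contra_not fin; rewrite eK => finD.
by apply: finite_preimage => // i j _ _; exact: e_inj.
Qed.

(** By [counting_preimage], the pushforward of the counting measure along [e] is again the counting
    measure on subsets of the range. *)
Lemma integral_counting_comp (f : J -> \bar R) : (forall j, 0 <= f j)%E ->
  (\int[counting]_i f (e i) = \int[counting]_(j in range e) f j)%E.
Proof.
move=> f0.
have me : measurable_fun [set: I] e by move=> _ Y _; exact: mI.
have := @ge0_integral_pushforward _ _ _ _ R e me (@counting I R) (range e) f
  (mJ _) (fun _ Y _ => mJ _) (fun j _ => f0 j).
rewrite (_ : e @^-1` range e = setT)/=; last first.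
  by apply/seteqP; split=> // i _; exists i.
move=> <-; apply: eq_measure_integral => D _ De.
exact: counting_preimage.
Qed.

Lemma lpnorm_comp_inj p y : (0 < p)%E -> (lpnorm p (y \o e) <= lpnorm p y)%E.
Proof.
case: p => [r|_|//]; last first.
  apply/lpnorm_infty_le => i /=.
  by move: (e i); apply/lpnorm_infty_le.
rewrite lte_fin => r0; rewrite !lpnormE; apply: gt0_ler_poweR.
- by rewrite invr_ge0 ltW.
- by rewrite in_itv/= leey andbT integral_ge0// => i _; rewrite lee_fin powR_ge0.
- by rewrite in_itv/= leey andbT integral_ge0// => i _; rewrite lee_fin powR_ge0.
rewrite (@integral_counting_comp (fun j => (normc (y j) `^ r)%:E)); last first.
  by move=> j; rewrite lee_fin powR_ge0.
apply: ge0_subset_integral => //.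
by move=> j _; rewrite lee_fin powR_ge0.
Qed.

Lemma lp_comp_inj p y : (0 < p)%E -> lp p y -> lp p (y \o e).
Proof. by move=> p0; apply: le_lt_trans; exact: lpnorm_comp_inj. Qed.

Lemma lp_extend p y : (0 < p)%E -> (forall j, ~ range e j -> y j = 0) ->
  lp p (y \o e) -> lp p y.
Proof.
case: p => [r||//] + ye.
  rewrite lte_fin => r0 /(lp_finP _ r0) yoo; apply/(lp_finP _ r0).
  apply: le_lt_trans yoo.
  rewrite (@integral_counting_comp (fun j => (normc (y j) `^ r)%:E)); last first.
    by move=> j; rewrite lee_fin powR_ge0.
  rewrite [leRHS]integral_mkcond le_eqVlt; apply/orP; left; apply/eqP.
  apply: eq_integral => j _.
  rewrite patchE; case: ifPn => // /negP; rewrite inE => /ye ->.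
  by rewrite /= expr0n addr0 sqrtr0 powR0 ?gt_eqF.
move=> _ /lp_inftyP[M yM]; apply/lp_inftyP; exists M => j.
have [[i _ <-]|/ye->] := pselect (range e j); first exact: yM.
(* [M] bounds a modulus at [point], so it is nonnegative. *)
rewrite /= expr0n addr0 sqrtr0.
by apply: le_trans (yM point); exact: normc_ge0.
Qed.

End Reindex.

(** * Truncation to windows and its convergence *)

Section Truncation.
Context {R : realType}.
Implicit Types (x y b : int -> R[i]) (p : \bar R) (l r : int).

(** The projection P of the finite section method, kept on all of Z so that truncated and full
    systems share one space. *)
Definition window l r y : int -> R[i] := fun j => if l <= j <= r then y j else 0.

Lemma int_measurable (A : set int) : measurable A. Proof. by []. Qed.
Lemma nat_measurable (A : set nat) : measurable A. Proof. by []. Qed.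

Lemma le_normc_window l r y j : normc (window l r y j) <= normc (y j).
Proof.
rewrite /window; case: ifP => // _.
by rewrite [leLHS]ComplexField.Normc.normc0 normc_ge0.
Qed.

Lemma lpnorm_window p l r y : (0 < p)%E -> (lpnorm p (window l r y) <= lpnorm p y)%E.
Proof. by move=> p0; apply: le_lpnorm => // j; exact: le_normc_window. Qed.

Lemma lp_window p l r y : (1 <= p)%E -> lp p (window l r y).
Proof.
move=> p1; apply: (@lp_finite_support _ _ _ int_measurable _ _
  ((fun n : nat => l + n%:Z) @` `I_(`|r - l|.+1)%N)) => //.
  by apply: finite_image; exact: finite_II.
move=> j nj; rewrite /window; case: ifP => // /andP[lj jr]; exfalso; apply: nj.
exists (`|j - l|)%N => /=; lia.
Qed.

Lemma ge0_cvg0P (u : nat -> \bar R) : (forall n, 0 <= u n)%E ->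
  (u n @[n --> \oo] --> 0%E) <->
  (forall e : R, 0 < e -> \forall n \near \oo, (u n <= e%:E)%E).
Proof.
move=> u0; split=> [/fine_cvgP[ufin ucvg] e e0|ue].
  near=> n; have un : u n \is a fin_num by near: n.
  rewrite -(fineK un) lee_fin -[leLHS]ger0_norm ?fine_ge0// -normrN -sub0r.
  by near: n; move/cvgrPdist_le: ucvg; apply.
have ufin e : 0 < e -> \forall n \near \oo, u n \is a fin_num /\ (u n <= e%:E)%E.
  move=> e0; near=> n; have ne : (u n <= e%:E)%E by near: n; exact: ue.
  by split=> //; rewrite ge0_fin_numE//; apply: le_lt_trans ne _; exact: ltry.
apply/fine_cvgP; split; first by apply: filterS (ufin 1 ltr01) => n [].
apply/cvgrPdist_le => e e0; apply: filterS (ufin e e0) => n [un une].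
by rewrite sub0r normrN /= ger0_norm ?fine_ge0// -lee_fin fineK.
Unshelve. all: by end_near. Qed.

Lemma cvg_poweR0 (u : nat -> \bar R) (s : R) : 0 < s ->
  (forall n, 0 <= u n)%E -> u n @[n --> \oo] --> 0%E ->
  ((u n) `^ s)%E @[n --> \oo] --> 0%E.
Proof.
move=> s0 u0 /(ge0_cvg0P u0) ue; apply/ge0_cvg0P => [n|e e0].
  exact: poweR_ge0.
have /ue : 0 < e `^ s^-1 by exact: powR_gt0.
apply: filterS => n une.
rewrite (_ : e%:E = ((e `^ s^-1)%:E `^ s)%E); last first.
  by rewrite poweR_EFin -powRrM mulVf ?gt_eqF// powRr1// ltW.
by apply: gt0_ler_poweR => //; first exact: ltW;
  rewrite in_itv/= leey andbT// lee_fin powR_ge0.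
Qed.

(** Dominated convergence with dominating function |y|^s. The constant sequence 1 shows that this
    fails for p = oo, which therefore gets its own argument below. *)
Lemma cvg_lpnorm_window p (l r : nat -> int) y : (1 <= p)%E -> (p < +oo)%E ->
  cutoffs l r -> lp p y ->
  lpnorm p (fun j => window (l n) (r n) y j - y j) @[n --> \oo] --> 0%E.
Proof.
case: p => [s|//|//]; rewrite lee_fin => s1 _ [lcut rcut].
have s0 : 0 < s by exact: lt_le_trans s1.
move=> /(lp_finP _ s0) yoo.
pose f n j := (normc (window (l n) (r n) y j - y j) `^ s)%:E.
pose g j := (normc (y j) `^ s)%:E.
have f0 n j : (0 <= f n j)%E by rewrite lee_fin powR_ge0.
have m := measurable_discrete int_measurable.
rewrite (_ : (fun n => lpnorm _ _) =
    fun n => ((\int[counting]_j f n j) `^ s^-1)%E); last first.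
  by apply/funext => n; rewrite lpnormE.
apply: cvg_poweR0; first by rewrite invr_gt0.
  by move=> n; exact: integral_ge0.
have [| | | | |_ _] := @dominated_convergence _ _ _ (@counting int R) setT
  measurableT f (cst 0%E) g.
- by move=> n; exact: m.
- exact: m.
- apply: nearW => j _; apply/ge0_cvg0P => // e e0.
  near=> n.
  have lj : l n <= j by near: n; exact: lcut.
  have rj : j <= r n by near: n; exact: rcut.
  rewrite /f /window lj rj/= subrr [normc _]ComplexField.Normc.normc0.
  by rewrite powR0 ?gt_eqF// lee_fin ltW.
- apply/integrableP; split; first exact: m.
  by rewrite (eq_integral g)// => j _; rewrite gee0_abs// lee_fin powR_ge0.
- apply: nearW => j n _; rewrite gee0_abs// lee_fin.
  apply: ge0_ler_powR; rewrite ?nnegrE ?normc_ge0//; first exact: ltW.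
  rewrite /window; case: ifP => _; last by rewrite sub0r normcN.
  by rewrite subrr [leLHS]ComplexField.Normc.normc0 normc_ge0.
by rewrite integral0.
Unshelve. all: by end_near. Qed.

End Truncation.

(** * Bounds on the dimension of a quotient *)

Section QuotientDim.
Context {R : realType} {I : Type}.
Implicit Types (V W : set (I -> R[i])).

Lemma quotient_dim0 V W y : quotient_dim V W 0 -> V y -> W y.
Proof.
move=> [v [_ /(_ y)]] + Vy => /(_ Vy) [c [+ _]].
by under eq_fun do rewrite big_ord0 subr0.
Qed.

Let sum_delta n (k0 : 'I_n) (f : 'I_n -> R[i]) :
  \sum_(k < n) (k == k0)%:R * f k = f k0.
Proof.
rewrite (bigD1 k0)//= eqxx mul1r big1 ?addr0// => k /negbTE ->.
by rewrite mul0r.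
Qed.

(** If V were contained in W, the first basis vector would have both the zero row and a unit row as
    coordinates, against uniqueness. *)
Lemma quotient_dim_gt0 V W n : W (cst 0) -> quotient_dim V W n -> (0 < n)%N ->
  exists2 v, V v & ~ W v.
Proof.
move=> W0 [v [Vv uniq_v]] n0; apply: contrapT => nex.
have {nex} VW u : V u -> W u by move=> Vu; apply: contrapT => nWu; apply: nex; exists u.
pose k0 := Ordinal n0.
have [c [_ c_uniq]] := uniq_v _ (Vv k0).
have c0 : c = 0.
  apply: c_uniq; under eq_fun do under eq_bigr do rewrite mxE mul0r.
  by under eq_fun do rewrite big1// subr0; exact/VW/Vv.
have : c = \row_k (k == k0)%:R.
  apply: c_uniq; under eq_fun do under eq_bigr do rewrite mxE.
  by under eq_fun do rewrite sum_delta subrr; exact: W0.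
rewrite c0 => /rowP/(_ k0); rewrite !mxE eqxx => /esym/eqP.
by rewrite oner_eq0.
Qed.

(** If the class of [e] spans, then two basis vectors are dependent modulo W, so the first of them
    has two coordinate rows. *)
Lemma quotient_dim_le1 V W n (e : I -> R[i]) : W (cst 0) ->
  (forall (c : R[i]) x y, W x -> W y -> W (fun i => c * x i + y i)) ->
  (forall y, V y -> exists t : R[i], W (fun i => y i - t * e i)) ->
  quotient_dim V W n -> (n <= 1)%N.
Proof.
move=> W0 Wlin We [v [Vv uniq_v]]; rewrite leqNgt; apply/negP => n1.
pose k0 := Ordinal (ltnW n1); pose k1 := Ordinal n1.
have k10 : (k1 == k0) = false by [].
have [t0 Wt0] := We _ (Vv k0); have [t1 Wt1] := We _ (Vv k1).
have [c [_ c_uniq]] := uniq_v _ (Vv k0).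
have c1 : c = \row_k (k == k0)%:R.
  apply: c_uniq; under eq_fun do under eq_bigr do rewrite mxE.
  by under eq_fun do rewrite sum_delta subrr; exact: W0.
have [t00|t0N0] := eqVneq t0 0.
  have : c = 0.
    apply: c_uniq; under eq_fun do under eq_bigr do rewrite mxE mul0r.
    under eq_fun do rewrite big1// subr0.
    by move: Wt0; rewrite t00; under eq_fun do rewrite mul0r subr0.
  by rewrite c1 => /rowP/(_ k0); rewrite !mxE eqxx => /eqP; rewrite oner_eq0.
(* From v0 = t0 e and v1 = t1 e modulo W, the combination t1 v0 - t0 v1 lies in W; hence (1 - t1) v0
   + t0 v1 also represents v0. *)
have : c = \row_k ((k == k0)%:R * (1 - t1) + (k == k1)%:R * t0).
  apply: c_uniq.
  rewrite (_ : (fun i => _) =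
    fun i => t1 * (v k0 i - t0 * e i) + (- t0 * (v k1 i - t1 * e i) + cst 0 i)).
    by apply: (Wlin t1) => //; apply: (Wlin (- t0)).
  apply/funext => i; under eq_bigr do rewrite mxE mulrDl -!mulrA.
  by rewrite big_split/= !sum_delta; ring.
rewrite c1 => /rowP/(_ k1); rewrite !mxE k10 eqxx mul0r add0r mul1r => /esym/eqP.
by rewrite (negbTE t0N0).
Qed.

End QuotientDim.

(** * Tridiagonal matrices and their compressions to half-lines *)

Section Tridiagonal.
Context {R : realType}.
Implicit Types (a : int -> int -> R[i]) (x y : int -> R[i]) (k i j : int).

Definition tridiagonal a := forall i j, 1 < `|i - j| -> a i j = 0.

Lemma tridiagonal_act a x i : tridiagonal a -> infmx_act a x i =
  a i (i - 1) * x (i - 1) + a i i * x i + a i (i + 1) * x (i + 1).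
Proof.
move=> ta; rewrite /infmx_act.
rewrite -(fsbig_widen [set` [:: i - 1; i; i + 1]] setT)//.
  rewrite -fsbig_seq.
    by rewrite !big_cons big_nil /= addr0 addrA.
  by rewrite !cons_uniq !in_cons !in_nil /=; lia.
move=> j [_ /=]; rewrite !in_cons in_nil => /negP nj.
by rewrite ta ?mul0r//; lia.
Qed.

Lemma tridiagonal_linear a (c : R[i]) x y : tridiagonal a ->
  infmx_act a (fun i => c * x i + y i) =
  fun i => c * infmx_act a x i + infmx_act a y i.
Proof. by move=> ta; apply/funext => i; rewrite !tridiagonal_act//; ring. Qed.

Definition compress k a : nat -> nat -> R[i] := fun m n => a (k + m%:Z) (k + n%:Z).

Definition restrict_from k x : nat -> R[i] := fun n => x (k + n%:Z).

Definition extend_from k (v : nat -> R[i]) : int -> R[i] :=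
  fun j => if k <= j then v `|j - k|%N else 0.

Lemma extend_from_restrict k x j : k <= j -> extend_from k (restrict_from k x) j = x j.
Proof. by move=> kj; rewrite /extend_from kj /restrict_from; congr x; lia. Qed.

Lemma extend_from_lt k (v : nat -> R[i]) j : j < k -> extend_from k v j = 0.
Proof. by move=> jk; rewrite /extend_from leNgt jk. Qed.

Lemma restrict_extend k (v : nat -> R[i]) : restrict_from k (extend_from k v) = v.
Proof.
apply/funext => n; rewrite /restrict_from /extend_from ifT; last by lia.
by congr v; lia.
Qed.

(** Moves questions about the half-line operator to Z, where the three-term formula
    [tridiagonal_act] is available. *)
Lemma compress_act k a (v : nat -> R[i]) :
  infmx_act (compress k a) v = restrict_from k (infmx_act a (extend_from k v)).
Proof.
apply/funext => m; rewrite /restrict_from /infmx_act.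
pose e (n : nat) := k + n%:Z.
rewrite -[RHS](fsbig_widen (range e) setT)//; last first.
  move=> j [_ /= nj]; rewrite extend_from_lt ?mulr0// ltNge; apply/negP => kj.
  by apply: nj; exists `|j - k|%N => //; rewrite /e; lia.
rewrite (@reindex_fsbig _ _ _ _ _ e setT (range e)).
  apply: eq_fsbigr => n _; rewrite /compress; congr (_ * _).
  by rewrite -[in LHS](restrict_extend k v).
apply: inj_bij => n n' _ _; rewrite /e; lia.
Qed.

Lemma tridiagN_compress (U V W : set R[i]) k a :
  tridiagZ U V W a -> tridiagN U V W (compress k a).
Proof.
move=> [aU aV aW a0]; split=> [n|n|n|m n mn]; rewrite /compress.
- by have := aU (k + n.+1%:Z); congr (U (a _ _)); lia.
- exact: aV.
- by have := aW (k + n%:Z); congr (W (a _ _)); lia.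
- by apply: a0; lia.
Qed.

Lemma lp_restrict_from p k x : (0 < p)%E -> lp p x -> lp p (restrict_from k x).
Proof.
have e_inj : injective (fun n : nat => k + n%:Z) by move=> m n; lia.
exact: (lp_comp_inj nat_measurable int_measurable e_inj).
Qed.

Lemma lp_extend_from p k (v : nat -> R[i]) :
  (0 < p)%E -> lp p v -> lp p (extend_from k v).
Proof.
move=> p0 vp.
have e_inj : injective (fun n : nat => k + n%:Z) by move=> m n; lia.
apply: (lp_extend nat_measurable int_measurable e_inj) => //.
- move=> j nj; rewrite extend_from_lt// ltNge; apply/negP => kj.
  by apply: nj; exists `|j - k|%N => //; lia.
- by rewrite (_ : _ \o _ = v)//; exact: restrict_extend.
Qed.

End Tridiagonal.

(** * From the index of the compressions to supports of solutions *)

Lemma invertible_inj (R : realType) d (I : measurableType d) (p : \bar R)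
    (T : (I -> R[i]) -> I -> R[i]) x y :
  invertible p T -> lp p x -> lp p y -> T x = T y -> x = y.
Proof.
move=> [_ [B [_ BT]]] xp yp Txy.
by rewrite -(BT _ xp).1 Txy (BT _ yp).1.
Qed.

Lemma invertible_surj (R : realType) d (I : measurableType d) (p : \bar R)
    (T : (I -> R[i]) -> I -> R[i]) y :
  invertible p T -> lp p y -> exists2 x, lp p x & T x = y.
Proof.
move=> [_ [B [[Bp _ _] BT]]] yp; exists (B y); first exact: Bp.
by rewrite (BT _ yp).2.
Qed.

Section SupportPropagation.
Context {R : realType} (p : \bar R) (p1 : (1 <= p)%E).
Context (A : int -> int -> R[i]) (tA : tridiagonal A).
Hypothesis invA : invertible p (infmx_act A).
Implicit Types (x y : int -> R[i]) (v w : nat -> R[i]) (k : int).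

Local Notation T k := (infmx_act (compress k A)).

Let p0 : (0 < p)%E. Proof. exact: lt_le_trans p1. Qed.

Let actA x i : infmx_act A x i =
  A i (i - 1) * x (i - 1) + A i i * x i + A i (i + 1) * x (i + 1).
Proof. exact: tridiagonal_act. Qed.

Let T_linear k (c : R[i]) v w :
  T k (fun n => c * v n + w n) = fun n => c * T k v n + T k w n.
Proof.
rewrite !compress_act (_ : extend_from k _ =
  fun j => c * extend_from k v j + extend_from k w j).
  by rewrite tridiagonal_linear.
by apply/funext => j; rewrite /extend_from; case: ifP => // _; rewrite mulr0 addr0.
Qed.

Let T0 k : T k (cst 0) = cst 0.
Proof.
rewrite compress_act; apply/funext => n; rewrite /restrict_from actA.
by rewrite /extend_from !if_same !mulr0 !addr0.
Qed.

Let extend_act_below k v i : i < k - 1 -> infmx_act A (extend_from k v) i = 0.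
Proof. by move=> ik; rewrite actA !extend_from_lt ?mulr0 ?addr0//; lia. Qed.

Let extend_act_boundary k v :
  infmx_act A (extend_from k v) (k - 1) = A (k - 1) k * v 0%N.
Proof.
rewrite actA !(@extend_from_lt _ k v (_ - 1)) ?mulr0 ?add0r; try lia.
by rewrite subrK -{2}(restrict_extend k v) /restrict_from addr0.
Qed.

Let extend_act_above k v i : k <= i ->
  infmx_act A (extend_from k v) i = T k v `|i - k|%N.
Proof. by move=> ki; rewrite compress_act /restrict_from; congr infmx_act; lia. Qed.

(** Outside [k, +oo), the only row of [A] that meets the extension of [v] by zero is row [k - 1],
    with value [A (k - 1) k * v 0]. If that vanishes too, [A] kills the extension and injectivity
    applies. *)
Lemma compress_kernel_eq0 k v : lp p v -> T k v = cst 0 ->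
  A (k - 1) k * v 0%N = 0 -> v = cst 0.
Proof.
move=> vp Tv v0.
have : extend_from k v = cst 0.
  apply: (invertible_inj invA); first exact: lp_extend_from.
    exact: lp0.
  apply/funext => i; rewrite [RHS]actA !mulr0 !addr0.
  have [ki|] := leP k i; first by rewrite extend_act_above// Tv.
  move=> ik; have [->|ik1] := eqVneq i (k - 1); first by rewrite extend_act_boundary.
  by rewrite extend_act_below//; lia.
by move/(congr1 (restrict_from k)); rewrite restrict_extend.
Qed.

Section IndexOne.
Hypothesis index1 : forall k, fredholm_index p (T k) 1.

(** Index 1 means n = m + 1, so the kernel is nonzero. By [compress_kernel_eq0] a kernel vector is
    determined by its entry at 0, so n = 1 and m = 0. *)
Let kernel_surj k : (exists v, [/\ lp p v, T k v = cst 0 & A (k - 1) k * v 0%N != 0])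
  /\ forall w, lp p w -> exists2 v, lp p v & T k v = w.
Proof.
have [_ [n [m [kern coker nm]]]] := index1 k.
have n0 : (0 < n)%N by lia.
have [v [/= vp Tv] vN0] := quotient_dim_gt0 erefl kern n0.
have Av0 : A (k - 1) k * v 0%N != 0.
  by apply/eqP => Av0; apply: vN0; exact: compress_kernel_eq0 Av0.
split; first by exists v.
have n1 : (n <= 1)%N.
  apply: (quotient_dim_le1 (e := v) _ _ _ kern) => //=.
    by move=> c x y -> ->; apply/funext => i; rewrite mulr0 addr0.
  (* This multiple of [v] cancels the entry of [u] at 0. *)
  move=> u [/= up Tu]; exists (u 0%N / v 0%N).
  have -> : (fun i => u i - u 0%N / v 0%N * v i) =
            (fun i => - (u 0%N / v 0%N) * v i + u i).
    by apply/funext => i; ring.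
  apply: (@compress_kernel_eq0 k); first exact: lp_linear.
    by rewrite T_linear Tv Tu; apply/funext => i; rewrite mulr0 addr0.
  rewrite mulNr divfK ?addNr ?mulr0//.
  by apply: contraNneq Av0 => ->; rewrite mulr0.
have m0 : m = 0%N by lia.
move=> w wp; rewrite m0 in coker.
by have [u up <-] := quotient_dim0 coker wp; exists u.
Qed.

Lemma index1_superdiag_neq0 k : A (k - 1) k != 0.
Proof.
have [[v [_ _]]] := kernel_surj k.
by rewrite mulf_eq0 negb_or => /andP[].
Qed.

(** The thresholds [k - 1] for rows and [k] for entries differ by the shift: for S A both become
    [k]. *)
Lemma index1_support k x : lp p x ->
  (forall i, i < k - 1 -> infmx_act A x i = 0) -> forall i, i < k -> x i = 0.
Proof.
move=> xp Ax0 i ik; set y := infmx_act A x.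
have yp : lp p y by case: invA => -[+ _ _] _; exact.
have [[v [vp Tv Av0]] surj] := kernel_surj k.
have [w wp Tw] := surj _ (lp_restrict_from k p0 yp).
(* Adding a multiple of the kernel vector [v] leaves the rows from [k] on unchanged; [c] is the
   multiple for which row [k - 1] yields [y (k - 1)]. *)
pose c := (y (k - 1) - A (k - 1) k * w 0%N) / (A (k - 1) k * v 0%N).
pose u n := c * v n + w n.
have up : lp p u by exact: lp_linear.
suff -> : x = extend_from k u by rewrite extend_from_lt.
apply: (invertible_inj invA) => //; first exact: lp_extend_from.
apply/funext => j; rewrite -/y.
have [kj|] := leP k j.
  rewrite extend_act_above// T_linear Tv Tw mulr0 add0r /restrict_from.
  by congr y; lia.
move=> jk; have [->|jk1] := eqVneq j (k - 1); last first.
  by rewrite extend_act_below /y ?Ax0//; lia.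
rewrite extend_act_boundary /u /c mulrDr mulrCA divfK//.
by rewrite subrK.
Qed.

End IndexOne.

Section IndexMinusOne.
Hypothesis indexN1 : forall k, fredholm_index p (T k) (-1).

Let delta0 : nat -> R[i] := fun n => (n == 0%N)%:R.

(** Row [k] is the only row of the half-line that reads an entry to the left of [k], so dropping
    those entries changes coordinate 0 only. *)
Let T_restrict k x : T k (restrict_from k x) =
  fun n => restrict_from k (infmx_act A x) n - A k (k - 1) * x (k - 1) * delta0 n.
Proof.
rewrite compress_act; apply/funext => n; rewrite /restrict_from !actA.
rewrite !(@extend_from_restrict _ k x (k + n%:Z)) ?(@extend_from_restrict _ k x (k + n%:Z + 1)); try lia.
case: n => [|n]; rewrite /delta0/=.
  by rewrite extend_from_lt ?addr0 ?mulr0 ?mulr1; [ring|lia].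
by rewrite extend_from_restrict ?mulr0 ?subr0//; lia.
Qed.

(** Index -1 means m = n + 1. Surjectivity of [A] makes the image together with [delta0] span
    everything, so m = 1 and n = 0. Some [w] is then missed by the image, and both [delta0] in the
    image and a zero subdiagonal entry would put [w] into it. *)
Let compress_facts k : [/\ A k (k - 1) != 0,
  forall v, lp p v -> T k v = cst 0 -> v = cst 0 &
  forall v (t : R[i]), lp p v -> T k v = (fun n => t * delta0 n) -> t = 0].
Proof.
have [_ [n [m [kern coker nm]]]] := indexN1 k.
(* Solve with [A] on Z for [w] extended by zero, then restrict the solution. *)
have almost_surj w : lp p w -> exists2 v, lp p v &
    exists t : R[i], T k v = (fun n => w n - A k (k - 1) * t * delta0 n).
  move=> wp; have [x xp Ax] := invertible_surj invA (lp_extend_from k p0 wp).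
  exists (restrict_from k x); first exact: lp_restrict_from.
  by exists (x (k - 1)); rewrite T_restrict Ax restrict_extend.
have im0 : [set T k u | u in lp p] (cst 0).
  by exists (cst 0); [exact: lp0|exact: T0].
have im_lin (c : R[i]) v w : [set T k u | u in lp p] v ->
    [set T k u | u in lp p] w -> [set T k u | u in lp p] (fun i => c * v i + w i).
  move=> [v' v'p <-] [w' w'p <-]; exists (fun i => c * v' i + w' i).
    exact: lp_linear.
  exact: T_linear.
have m1 : (m <= 1)%N.
  apply: (quotient_dim_le1 (e := delta0) im0 im_lin _ coker) => w wp.
  by have [v vp [t Tv]] := almost_surj w wp; exists (A k (k - 1) * t); exists v.
have n0 : n = 0%N by lia.
have m0 : (0 < m)%N by lia.
have [w wp wN] := quotient_dim_gt0 im0 coker m0.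
have [v vp [t Tv]] := almost_surj w wp.
have delta0N : ~ [set T k u | u in lp p] delta0.
  move=> d0; apply: wN.
  have := im_lin (A k (k - 1) * t) _ _ d0 (ex_intro2 _ _ v vp erefl).
  by rewrite Tv; congr (image _ _ _); apply/funext => i; ring.
split.
- apply: contra_notN wN => /eqP A0; exists v => //.
  by rewrite Tv A0; apply/funext => i; ring.
- move=> u up Tu; rewrite n0 in kern.
  by have := quotient_dim0 kern (conj up Tu).
- move=> u s up Tu; apply: contrapT => /eqP s0; apply: delta0N.
  have := im_lin s^-1 _ _ (ex_intro2 _ _ u up erefl) im0.
  rewrite Tu; congr (image _ _ _); apply/funext => i.
  by rewrite /= addr0 mulKf.
Qed.

Lemma indexN1_subdiag_neq0 k : A k (k - 1) != 0.
Proof. by have [] := compress_facts k. Qed.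

Lemma indexN1_support k x : lp p x ->
  (forall i, k + 1 < i -> infmx_act A x i = 0) -> forall i, k < i -> x i = 0.
Proof.
move=> xp Ax0 i ki; have [_ ker0 noimage] := compress_facts (k + 1).
set w := restrict_from (k + 1) x.
have wp : lp p w by exact: lp_restrict_from.
(* Row [k + 1] is the one row of the half-line where [infmx_act A x] may be nonzero, and also the
   one where restricting makes a difference. *)
have Tw : T (k + 1) w = fun n => T (k + 1) w 0%N * delta0 n.
  apply/funext => -[|n]; rewrite /delta0 ?mulr1// mulr0 T_restrict /delta0 mulr0 subr0.
  by rewrite /restrict_from Ax0//; lia.
have t0 := noimage _ _ wp Tw.
have /ker0 : T (k + 1) w = cst 0 by rewrite Tw t0; apply/funext => n; rewrite mul0r.
move=> /(_ wp)/(congr1 (@^~ `|(i - (k + 1))%R|%N))/=; rewrite /w /restrict_from => <-.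
by congr x; lia.
Qed.

End IndexMinusOne.

End SupportPropagation.

(** * Band matrices and truncated systems *)

Section BandMatrix.
Context {R : realType}.
Implicit Types (a : int -> int -> R[i]) (x y b : int -> R[i]) (l r i j : int).

(** Width two accommodates both S A and S^-1 A, so that the two signs of kappa share one
    treatment. *)
Definition pentadiagonal a := forall i j, 2 < `|i - j| -> a i j = 0.

Let nbrs i := [:: i - 2; i - 1; i; i + 1; i + 2].

Lemma pentadiagonal_act a x i : pentadiagonal a ->
  infmx_act a x i = \sum_(j <- nbrs i) a i j * x j.
Proof.
move=> pa; rewrite /infmx_act.
rewrite -(fsbig_widen [set` nbrs i] setT)//.
  by rewrite -fsbig_seq// /nbrs !cons_uniq !in_cons !in_nil /=; lia.
move=> j [_ /=]; rewrite !in_cons in_nil => /negP nj.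
by rewrite pa ?mul0r//; lia.
Qed.

Lemma pentadiagonal_linear a (c : R[i]) x y : pentadiagonal a ->
  infmx_act a (fun i => c * x i + y i) =
  fun i => c * infmx_act a x i + infmx_act a y i.
Proof.
move=> pa; apply/funext => i; rewrite !pentadiagonal_act//.
rewrite mulr_sumr -big_split/=; apply: eq_bigr => j _; ring.
Qed.

Lemma infmx_act_delta a i j : infmx_act a (fun k => (k == j)%:R) i = a i j.
Proof.
rewrite /infmx_act -(fsbig_widen [set j] setT)//.
  by rewrite fsbig_set1 eqxx mulr1.
by move=> k [_ /= kj]; rewrite (negbTE (introN eqP kj)) mulr0.
Qed.

(** The entries are values of the operator on unit vectors, which have supremum norm at most 1. *)
Lemma bounded_operator_entries a : bounded_operator +oo (infmx_act a) ->
  exists K : R, forall i j, normc (a i j) <= K.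
Proof.
move=> [_ _ [M aM]]; exists `|M| => i j; rewrite -lee_fin -infmx_act_delta.
have d1 : (lpnorm +oo (fun k : int => (k == j)%:R : R[i]) <= 1)%E.
  apply/lpnorm_infty_le => k; rewrite lee_fin.
  case: eqP => _; first by rewrite [leLHS]ComplexField.Normc.normc1.
  by rewrite [leLHS]ComplexField.Normc.normc0 ler01.
move: i; apply/lpnorm_infty_le; apply: le_trans (aM _ _) _.
  by apply: le_lt_trans d1 _; exact: ltry.
apply: (@le_trans _ _ (`|M|%:E * lpnorm +oo (fun k : int => (k == j)%:R : R[i]))%E).
  by apply: lee_wpmul2r; [exact: lpnorm_ge0|rewrite lee_fin ler_norm].
by rewrite -[leRHS]mule1; apply: lee_wpmul2l => //; rewrite lee_fin.
Qed.

Lemma bounded_operator_ge0 d (I : measurableType d) (p : \bar R)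
    (T : (I -> R[i]) -> I -> R[i]) : bounded_operator p T ->
  exists2 M : R, 0 <= M & forall u, lp p u -> (lpnorm p (T u) <= M%:E * lpnorm p u)%E.
Proof.
move=> [_ _ [M TM]]; exists `|M| => // u up; apply: le_trans (TM _ up) _.
by apply: lee_wpmul2r; [exact: lpnorm_ge0|rewrite lee_fin ler_norm].
Qed.

(** Replaces the finite sum by the action of the full matrix, to which linearity and the support
    lemmas apply. *)
Lemma truncated_solutionE a l r b x : truncated_solution a l r b x <->
  x = window l r x /\ forall i, l <= i <= r -> infmx_act a x i = b i.
Proof.
have cutE : (forall j, ~ (l <= j <= r) -> x j = 0) <-> (x = window l r x).
  split=> [x0|-> j nj]; last by rewrite /window ifN//; exact/negP.
  by apply/funext => j; rewrite /window; case: ifPn => // /negP /x0.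
split=> -[x0 ax]; (split; first exact/cutE).
- move=> i il; rewrite -ax// /infmx_act.
  rewrite -(fsbig_widen [set j : int | l <= j <= r] setT)//.
  by move=> j [_ /= nj]; rewrite /= (x0 _ nj) mulr0.
- move/cutE: x0 => x0 i il; rewrite -ax// /infmx_act.
  rewrite -[RHS](fsbig_widen [set j : int | l <= j <= r] setT)//.
  by move=> j [_ /= nj]; rewrite /= (x0 _ nj) mulr0.
Qed.

End BandMatrix.

(** * Truncated systems of triangular matrices with triangular inverse *)

Section TriangularSections.
(* For s = 1 (resp. -1) [L] is lower (resp. upper) triangular, and [suppL] says
   the same of its inverse. *)
Context {R : realType} (p : \bar R) (s : int).
Hypothesis s1 : s = -1 \/ s = 1.
Context (L : int -> int -> R[i]).
Hypothesis triL : forall i j, s * i < s * j -> L i j = 0.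
Hypothesis suppL : forall (k : int) x, lp p x ->
  (forall i, s * i < k -> infmx_act L x i = 0) -> forall i, s * i < k -> x i = 0.
Implicit Types (x y b z : int -> R[i]) (l r i j : int).

(** Cutting [z] off costs nothing in the rows of the window: on one side of it the coefficients of
    [L] vanish by triangularity, on the other side [z] itself vanishes by [suppL]. *)
Lemma triangular_window_solution l r b z : lp p z -> infmx_act L z = window l r b ->
  truncated_solution L l r b (window l r z).
Proof.
move=> zp Lz; apply/truncated_solutionE; split.
  by apply/funext => j; rewrite /window; case: ifP.
move=> i il; have -> : b i = infmx_act L z i by rewrite Lz /window il.
rewrite /infmx_act; apply: eq_fsbigr => j _; rewrite {1}/window.
case: ifPn => // jl; have [ij|ji] := ltP (s * i) (s * j).
  by rewrite triL// !mul0r.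
rewrite (@suppL (s * j + 1) z)//; last by lia.
move=> i' i'j; rewrite Lz /window ifN//.
by case: s1 => ss; rewrite ss in i'j ji; lia.
Qed.

Hypothesis p1 : (1 <= p)%E.

Lemma triangular_section_inj l r y : y = window l r y ->
  (forall i, l <= i <= r -> infmx_act L y i = 0) -> y = cst 0.
Proof.
move=> ycut Ly; apply/funext => j; rewrite ycut /window; case: ifPn => // jl.
(* The last point of the window in the order given by [s]. A row up to [e] lies in the window or
   strictly before it, and in the latter case triangularity makes it miss the support of [y]. *)
pose e := if s == 1 then r else l.
have eE : (s = 1 /\ e = r) \/ (s = -1 /\ e = l).
  by rewrite /e; case: s1 => ->; [right|left].
rewrite /=; apply: (@suppL (s * e + 1)).
- by rewrite ycut; exact: lp_window.
- move=> i ie; have [il|il] := boolP (l <= i <= r); first exact: Ly.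
  rewrite /infmx_act; apply: fsbig1 => k _; rewrite ycut /window; case: ifP => kl.
    rewrite triL ?mul0r//.
    by case: eE => -[ss ee]; rewrite ss ?ee in ie *; lia.
  by rewrite mulr0.
- by case: eE => -[ss ee]; rewrite ss ee; lia.
Qed.

Hypothesis pL : pentadiagonal L.
Hypothesis invL : invertible p (infmx_act L).

Lemma triangular_truncated_solution l r b :
  exists! x, truncated_solution L l r b x.
Proof.
have [z zp Lz] := invertible_surj invL (lp_window l r b p1).
have /truncated_solutionE[xcut Lx] := triangular_window_solution zp Lz.
exists (window l r z); split; first exact/truncated_solutionE.
move=> x' /truncated_solutionE[x'window Lx'].
have : (fun i => -1 * window l r z i + x' i) = cst 0.
  apply: (@triangular_section_inj l r).
    apply/funext => j; rewrite {1}x'window /window; case: ifP => // _.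
    by rewrite mulr0 addr0.
  move=> i il; rewrite pentadiagonal_linear// Lx// Lx'// mulN1r addNr//.
move=> E; apply/funext => j; have /= := congr1 (@^~ j) E.
by rewrite mulN1r addrC => /subr0_eq.
Qed.

End TriangularSections.

(** * Local decay of bounded solutions *)

Section LocalDecay.
Context {R : realType}.
Context (L : int -> int -> R[i]) (pL : pentadiagonal L).
Context (M K : R) (M0 : 0 <= M) (K0 : 0 <= K).
Hypothesis LK : forall i j, normc (L i j) <= K.
Hypothesis LM : forall x, lp +oo x ->
  (lpnorm +oo x <= M%:E * lpnorm +oo (infmx_act L x))%E.

(** Truncated subtraction makes the tent vanish exactly where |i - j| > N, that is, off the rows
    where [L w] is assumed to be zero. *)
Let tent (N : nat) (j i : int) : nat := (N.+1 - `|(i - j)%R|)%N.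

(* The commutator of L with multiplication by a tent of height N+1 and slope 1
   is bounded independently of N. *)
Lemma local_decay (N : nat) (j : int) (Q : R) (w : int -> R[i]) : 0 <= Q ->
  (forall i, normc (w i) <= Q) ->
  (forall i, j - N%:Z <= i <= j + N%:Z -> infmx_act L w i = 0) ->
  N%:R * normc (w j) <= M * (10 * K * Q).
Proof.
move=> Q0 wQ Lw; pose v i : R[i] := (tent N j i)%:R * w i.
have normc_nat (n : nat) : normc (n%:R : R[i]) = n%:R.
  have := normcMn (1 : Rcomplex R) n.
  by rewrite [normc (1 : Rcomplex R)]ComplexField.Normc.normc1.
have vp : lp +oo v.
  apply/lp_inftyP; exists (N.+1%:R * Q) => i.
  rewrite /v ComplexField.Normc.normcM normc_nat.
  by apply: ler_pM; rewrite ?normc_ge0// ler_nat /tent; lia.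
have Lv i : normc (infmx_act L v i) <= 10 * K * Q.
  (* The product of the tent with [L w] is zero in every row, so subtracting it leaves the
     commutator applied to [w]. *)
  have -> : infmx_act L v i = \sum_(k <- [:: i - 2; i - 1; i; i + 1; i + 2])
      L i k * (((tent N j k)%:R - (tent N j i)%:R) * w k).
    have : (tent N j i)%:R * infmx_act L w i = 0.
      have [il|il] := boolP (j - N%:Z <= i <= j + N%:Z); first by rewrite Lw ?mulr0.
      by rewrite (_ : tent N j i = 0%N) ?mul0r//; rewrite /tent; lia.
    rewrite !pentadiagonal_act// !big_cons !big_nil /v => E.
    by rewrite -[LHS]subr0 -E; ring.
  have term k : `|k - i| <= 2 ->
      normc (L i k * (((tent N j k)%:R - (tent N j i)%:R) * w k)) <= K * (2 * Q).
    move=> ki; rewrite !ComplexField.Normc.normcM.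
    apply: ler_pM; rewrite ?normc_ge0 ?mulr_ge0 ?normc_ge0//.
    apply: ler_pM; rewrite ?normc_ge0//.
    have [h|/ltnW h] := leqP (tent N j i) (tent N j k).
      by rewrite -natrB// normc_nat ler_nat /tent; lia.
    by rewrite -opprB normcN -natrB// normc_nat ler_nat /tent; lia.
  rewrite !big_cons big_nil addr0.
  (* Five band entries, each contributing at most [K] times a tent difference of at most 2 times
     [Q]. *)
  rewrite (_ : 10 * K * Q = K * (2 * Q) + (K * (2 * Q) + (K * (2 * Q) +
    (K * (2 * Q) + K * (2 * Q))))); last by ring.
  by do ?[apply: le_trans (le_normcD _ _) _; apply: lerD]; apply: term; lia.
have : (lpnorm +oo v <= (M * (10 * K * Q))%:E)%E.
  apply: le_trans (LM vp) _; rewrite EFinM.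
  apply: lee_wpmul2l; first by rewrite lee_fin.
  by apply/lpnorm_infty_le => i; rewrite lee_fin.
move=> /lpnorm_infty_le /(_ j); rewrite lee_fin; apply: le_trans.
rewrite /v ComplexField.Normc.normcM normc_nat; apply: ler_wpM2r; first exact: normc_ge0.
by rewrite ler_nat /tent; lia.
Qed.

End LocalDecay.

(** * Convergence of the finite section method *)

Section FiniteSection.
Context {R : realType} (p : \bar R) (p1 : (1 <= p)%E) (s : int).
Hypothesis s1 : s = -1 \/ s = 1.
Context (L : int -> int -> R[i]).
Hypothesis pL : pentadiagonal L.
Hypothesis triL : forall i j, s * i < s * j -> L i j = 0.
Hypothesis invL : invertible p (infmx_act L).
Hypothesis suppL : forall (k : int) x, lp p x ->
  (forall i, s * i < k -> infmx_act L x i = 0) -> forall i, s * i < k -> x i = 0.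

(** With B the inverse of [L], the error splits as P B (P b - b) + (P x - x), and both parts tend to
    zero by [cvg_lpnorm_window]. *)
Lemma truncated_approximates_fin (l r : nat -> int) (b x : int -> R[i]) xs :
  (p < +oo)%E -> cutoffs l r -> lp p b -> lp p x -> infmx_act L x = b ->
  (\forall n \near \oo, truncated_solution L (l n) (r n) b (xs n)) ->
  lpnorm p (fun j => xs n j - x j) @[n --> \oo] --> 0%E.
Proof.
move=> poo lr bp xp Lx xsol; have p0 : (0 < p)%E by exact: lt_le_trans p1.
have [_ [B [bB BL]]] := invL; have [Bp Blin _] := bB.
have [M M0 BM] := bounded_operator_ge0 bB.
(* [M] may be zero, so [M + 1] serves as the divisor below. *)
have M1 : 0 < M + 1 by rewrite ltr_wpDl.
apply/ge0_cvg0P => [n|e e0]; first exact: lpnorm_ge0.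
have cb := cvg_lpnorm_window p1 poo lr bp.
have cx := cvg_lpnorm_window p1 poo lr xp.
have e2 : 0 < e / 2 by rewrite divr_gt0.
move/ge0_cvg0P : cb => /(_ (fun n => lpnorm_ge0 _ _) (e / 2 / (M + 1))).
rewrite divr_gt0// => /(_ isT) cb.
move/ge0_cvg0P : cx => /(_ (fun n => lpnorm_ge0 _ _) (e / 2) e2) cx.
apply: filterS3 xsol cb cx => n xn cbn cxn.
set Pb := window (l n) (r n) b in cbn *; set Px := window (l n) (r n) x in cxn *.
have Pbp : lp p Pb by exact: lp_window.
have solB := triangular_window_solution s1 triL suppL (Bp _ Pbp) (BL _ Pbp).2.
have xnE : xs n = window (l n) (r n) (B Pb).
  have [y [_ yuniq]] := triangular_truncated_solution s1 triL suppL p1 pL invL (l n) (r n) b.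
  by rewrite -(yuniq _ xn) (yuniq _ solB).
pose dB := B (fun i => -1 * b i + Pb i).
have dBE : dB = fun i => -1 * x i + B Pb i.
  by rewrite /dB Blin// -Lx (BL _ xp).1.
have dbp : lp p (fun i => -1 * b i + Pb i) by exact: lp_linear.
rewrite (_ : (fun j => _) = fun j => window (l n) (r n) dB j + (Px j - x j)); last first.
  apply/funext => j; rewrite xnE dBE /Px /window; case: ifP => _; ring.
apply: le_trans (lpnormD int_measurable _ _ p1) _.
rewrite [e]splitr EFinD; apply: leeD => //.
apply: le_trans (lpnorm_window _ _ _ p0) _; apply: le_trans (BM _ dbp) _.
rewrite (_ : (fun i => -1 * b i + Pb i) = fun i => Pb i - b i); last first.
  by apply/funext => i; rewrite mulN1r addrC.
apply: (@le_trans _ _ (M%:E * (e / 2 / (M + 1))%:E)%E).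
  by apply: lee_wpmul2l => //; rewrite lee_fin.
rewrite -EFinM lee_fin mulrCA ler_piMr ?(ltW e2)//.
by rewrite ler_pdivrMr// mul1r lerDl.
Qed.

(** The difference of B (P b) and [x] is bounded uniformly in n, and [L] kills it on a growing
    window; [local_decay] then makes each entry small. *)
Lemma truncated_approximates_infty (l r : nat -> int) (b x : int -> R[i]) xs :
  p = +oo%E -> cutoffs l r -> lp p b -> lp p x -> infmx_act L x = b ->
  (\forall n \near \oo, truncated_solution L (l n) (r n) b (xs n)) ->
  (exists C : R, \forall n \near \oo, (lpnorm p (xs n) <= C%:E)%E) /\
  (forall j, (xs n j : R[i]^o) @[n --> \oo] --> (x j : R[i]^o)).
Proof.
move=> pE lr bp xp Lx xsol; have p0 : (0 < p)%E by exact: lt_le_trans p1.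
have [bL [B [bB BL]]] := invL; have [Bp Blin _] := bB.
have [M M0 BM] := bounded_operator_ge0 bB.
have /lp_inftyP[Qb bQ] : lp +oo b by rewrite -pE.
have /lp_inftyP[Qx xQ] : lp +oo x by rewrite -pE.
have windowp l' r' : lp p (window l' r' b) by exact: lp_window.
have normB l' r' : (lpnorm p (B (window l' r' b)) <= (M * Qb)%:E)%E.
  apply: le_trans (BM _ (windowp _ _)) _; rewrite EFinM.
  apply: lee_wpmul2l; first by rewrite lee_fin.
  apply: le_trans (lpnorm_window _ _ _ p0) _.
  by rewrite pE; apply/lpnorm_infty_le => i; rewrite lee_fin.
have xsE : \forall n \near \oo, xs n = window (l n) (r n) (B (window (l n) (r n) b)).
  apply: filterS xsol => n xn.
  have solB := triangular_window_solution s1 triL suppL (Bp _ (windowp _ _)) (BL _ (windowp _ _)).2.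
  have [y [_ yuniq]] := triangular_truncated_solution s1 triL suppL p1 pL invL (l n) (r n) b.
  by rewrite -(yuniq _ xn) (yuniq _ (solB _ _)).
split.
  exists (M * Qb); apply: filterS xsE => n ->.
  exact: le_trans (lpnorm_window _ _ _ p0) _.
move=> j; have [K LK] : exists K : R, forall i k, normc (L i k) <= K.
  by apply: bounded_operator_entries; rewrite -pE.
have K0 : 0 <= K by exact: le_trans (normc_ge0 _) (LK 0 0).
have LM u : lp +oo u -> (lpnorm +oo u <= M%:E * lpnorm +oo (infmx_act L u))%E.
  rewrite -pE => up; rewrite -{1}(BL _ up).1; apply: BM.
  by case: bL => + _ _; exact.
pose Q := M * Qb + Qx.
have Q0 : 0 <= Q.
  apply: addr_ge0; last exact: le_trans (normc_ge0 _) (xQ 0).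
  by rewrite mulr_ge0//; exact: le_trans (normc_ge0 _) (bQ 0).
(* The tolerance [e] is a complex number; being positive means zero imaginary part and positive real
   part. *)
apply/cvgrPdist_le => e; rewrite ltcE => /= /andP[/eqP e_im e_re].
(* Decay is applied with radius [N.+1], so that the factor to be cancelled is nonzero. *)
have [N NE] : exists N : nat, M * (10 * K * Q) <= N.+1%:R * complex.Re e.
  exists (Num.truncn (M * (10 * K * Q) / complex.Re e)).
  by rewrite -ler_pdivrMr// ltW// truncnS_gt.
have [lcut rcut] := lr.
apply: filterS3 xsE (lcut (j - N.+1%:Z)) (rcut (j + N.+1%:Z)) => n -> lj rj.
set z := B _.
have zj : window (l n) (r n) z j = z j by rewrite /window ifT//; lia.
have zp : lp p z by exact: Bp.
rewrite zj.
pose w i := -1 * x i + z i.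
have wQ i : normc (w i) <= Q.
  rewrite /w addrC mulN1r; apply: le_trans (le_normcD _ _) _; rewrite normcN.
  apply: lerD => //; rewrite -lee_fin.
  by move: i; apply/lpnorm_infty_le; rewrite -pE; exact: normB.
have Lw i : j - N.+1%:Z <= i <= j + N.+1%:Z -> infmx_act L w i = 0.
  move=> ij; rewrite /w pentadiagonal_linear// Lx (BL _ (windowp _ _)).2.
  by rewrite /window ifT ?mulN1r ?addNr//; lia.
have := local_decay pL M0 K0 LK LM Q0 wQ Lw.
move=> /le_trans/(_ NE); rewrite ler_pM2l ?ltr0n// => wj.
have -> : x j - z j = - w j by rewrite /w mulN1r opprD opprK.
rewrite lecE; apply/andP; split; first by rewrite /= e_im.
by rewrite normrN.
Qed.

Lemma triangular_fsm (l r : nat -> int) : cutoffs l r -> fsm_applies p L l r.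
Proof.
move=> lr; split=> //.
  apply: nearW => n b _.
  exact: (triangular_truncated_solution s1 triL suppL p1 pL invL).
move=> b x bp xp Lx xs xsol; rewrite /approximates; case: ifPn => poo.
  exact: truncated_approximates_fin xsol.
apply: truncated_approximates_infty xsol => //.
by apply/eqP; rewrite eq_le leey leNgt.
Qed.

End FiniteSection.

(** * Principal submatrices, the shift, and the final assembly *)

Lemma triangular_principal_unitmx (R : realType) (s : int) (L : int -> int -> R[i])
    (m : nat) (f : 'I_m -> int) : s != 0 ->
  (forall i j, s * i < s * j -> L i j = 0) -> (forall i, L i i != 0) ->
  injective f -> principal_submx L f \in unitmx.
Proof.
move=> s0 triL diagL f_inj; rewrite -unitmx_tr -row_free_unit -kermx_eq0.
apply/eqP/row_matrixP => k; rewrite row0.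
have : row k (kermx (principal_submx L f)^T) *m (principal_submx L f)^T = 0.
  by rewrite -row_mul mulmx_ker row0.
move: (row k _) => v vL; apply: contrapT => /eqP/rV0Pn[i0 vi0].
(* Among the nonzero coordinates of [v], take the first in the order of [s * f i]. The other nonzero
   ones come strictly later, so triangularity leaves only the diagonal term in row [i]; no
   monotonicity of [f] enters. *)
case: (@arg_minP _ _ _ i0 (fun i => v 0 i != 0) (fun i => s * f i) vi0) => i vi i_min.
move: vL => /rowP/(_ i); rewrite !mxE (bigD1 i)//= big1 ?addr0; last first.
  move=> j ji; rewrite !mxE; have [->|vj0] := eqVneq (v 0 j) 0.
    by rewrite mul0r.
  rewrite triL ?mulr0// lt_neqAle i_min// andbT.
  by apply: contraNneq ji => /(mulfI s0)/f_inj ->.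
by rewrite !mxE => /eqP; rewrite mulf_eq0 (negbTE vi) (negbTE (diagL _)).
Qed.

Lemma shift_act (R : realType) (k : int) (a : int -> int -> R[i]) x i :
  infmx_act (infmx_mul (shiftmx R k) a) x i = infmx_act a x (i - k).
Proof. by apply: eq_fsbigr => j _; rewrite shiftmx_mulE. Qed.

Lemma lpnorm_translate (R : realType) (p : \bar R) (k : int) (x : int -> R[i]) :
  (0 < p)%E -> (lpnorm p (fun i : int => x (i + k)%R) <= lpnorm p x)%E.
Proof.
have k_inj : injective (fun i : int => i + k) by exact: addIr.
exact: (lpnorm_comp_inj int_measurable int_measurable k_inj).
Qed.

Lemma shift_invertible (R : realType) (p : \bar R) (k : int)
    (a : int -> int -> R[i]) : (0 < p)%E ->
  invertible p (infmx_act a) ->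
  invertible p (infmx_act (infmx_mul (shiftmx R k) a)).
Proof.
move=> p0 [[ap alin [M aM]] [B [bB Ba]]].
have [Bp Blin _] := bB; have [M' M'0 BM] := bounded_operator_ge0 bB.
have tr j x : lp p x -> lp p (fun i : int => x (i + j)).
  by move=> xp; apply: le_lt_trans (lpnorm_translate j x p0) xp.
have actE x : infmx_act (infmx_mul (shiftmx R k) a) x =
    fun i => infmx_act a x (i - k).
  by apply/funext => i; exact: shift_act.
split; [split|].
- by move=> x xp; rewrite actE; apply: tr; exact: ap.
- by move=> c x y xp yp; rewrite !actE alin.
- exists M => x xp; rewrite actE.
  exact: le_trans (lpnorm_translate (- k) _ p0) (aM _ xp).
exists (fun y => B (fun i => y (i + k))); split; [split|].
- by move=> y yp; apply: Bp; exact: tr.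
- by move=> c x y xp yp; rewrite Blin//; exact: tr.
- exists M' => y yp; apply: le_trans (BM _ (tr _ _ yp)) _.
  by apply: lee_wpmul2l; [rewrite lee_fin|exact: lpnorm_translate].
move=> x xp; rewrite !actE; split.
  rewrite (_ : (fun i => _) = infmx_act a x) ?(Ba _ xp).1//.
  by apply/funext => i; rewrite addrK.
by rewrite (Ba _ (tr _ _ xp)).2; apply/funext => i; rewrite subrK.
Qed.

Theorem mainTheorem7 (R : realType) (U V W : set R[i]^o)
    (hU0 : U !=set0) (hV0 : V !=set0) (hW0 : W !=set0)
    (hU : compact U) (hV : compact V) (hW : compact W)
    (p : \bar R) (hp : (1 <= p)%E)
    (hcompat : compatible p U V W)
    (kappa : int) (hkappa : common_index p U V W kappa)
    (hkappa1 : kappa = -1 \/ kappa = 1)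
    (A : int -> int -> R[i]) (hA : tridiagZ U V W A) :
  let SA := infmx_mul (shiftmx R kappa) A in
  [/\ fsm_applies p SA (fun n => - n%:Z) (fun n => n%:Z),
      forall l r : nat -> int, monotonic_cutoffs l r -> fsm_applies p SA l r,
      forall (m : nat) (f : 'I_m -> int), injective f ->
        principal_submx SA f \in unitmx
    & forall (l r : int) (b : int -> R[i]),
        exists! x, truncated_solution SA l r b x].
Proof.
move=> SA; have p0 : (0 < p)%E by exact: lt_le_trans hp.
have invA := hcompat _ hA.
have tA : tridiagonal A by case: hA.
have idx k : fredholm_index p (infmx_act (compress k A)) kappa.
  by apply: hkappa; exact: tridiagN_compress.
have SAE i j : SA i j = A (i - kappa) j by exact: shiftmx_mulE.
have pSA : pentadiagonal SA.
  by move=> i j ij; rewrite SAE tA//; case: hkappa1 => ->; lia.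
have triSA i j : kappa * i < kappa * j -> SA i j = 0.
  by rewrite SAE => ij; apply: tA; case: hkappa1 ij => ->; lia.
have invSA : invertible p (infmx_act SA) by exact: shift_invertible.
have diagSA i : SA i i != 0.
  rewrite SAE; case: hkappa1 => kE; rewrite kE in idx *.
    (* For kappa = -1, row [i] of [SA] is row [i + 1] of [A], whose subdiagonal entry sits in column
       [i]. *)
    by have := indexN1_subdiag_neq0 hp tA invA idx (i + 1); rewrite addrK opprK.
  exact: (index1_superdiag_neq0 hp tA invA idx).
have suppSA (k : int) x : lp p x ->
    (forall i, kappa * i < k -> infmx_act SA x i = 0) ->
    forall i, kappa * i < k -> x i = 0.
  move=> xp SAx i; case: hkappa1 => kE; rewrite kE in idx SAx *.
    (* For kappa = -1 the condition [kappa * i < k] reads i > -k, hence the threshold [- k]; row [j]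
       of [A] is row [j - 1] of [SA]. *)
    move=> ik; apply: (indexN1_support hp tA invA idx (k := - k) xp); last by lia.
    move=> j kj; have := SAx (j - 1); rewrite shift_act kE opprK subrK; apply.
    by lia.
  move=> ik; apply: (index1_support hp tA invA idx (k := k) xp); last by lia.
  move=> j kj; have := SAx (j + 1); rewrite shift_act kE addrK; apply.
  by lia.
have fsm := triangular_fsm hp hkappa1 pSA triSA invSA suppSA.
split.
- apply: fsm; split=> k; near=> n.
  + have : (`|k| <= n)%N by near: n; exact: nbhs_infty_ge.
    by lia.
  + have : (`|k| <= n)%N by near: n; exact: nbhs_infty_ge.
    by lia.
- by move=> l r [lr _ _]; exact: fsm.
- move=> m f; apply: triangular_principal_unitmx triSA diagSA.
  by case: hkappa1 => ->.
- exact: (triangular_truncated_solution hkappa1 triSA suppSA hp pSA invSA).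
Unshelve. all: by end_near. Qed.
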